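(* Let $\hbar\neq0$ and $t_2\neq0$ be constants, and let $(q_1,q_2,p_1,p_2)=(q_1(t_1),q_2(t_1),p_1(t_1),p_2(t_1))$ be the convergent Laurent series solution at $t_1=\alpha$ of the Hamiltonian system of type $5/2+3/2$ in $t_1$, with free parameters $(\alpha,\beta,\gamma,\delta)$ independent of $t_1$ and $\beta\neq0$, given in the context. Then, with this solution substituted, the functions $Q_{\mathrm{Gar}_{5/2+3/2}}(x,t_1,t_2)$ and $A_{\mathrm{Gar}_{5/2+3/2},2}(x,t_1,t_2)$ have finite limits as $t_1\to\alpha$: $$\lim_{t_1\to\alpha}Q_{\mathrm{Gar}_{5/2+3/2}}(x,t_1,t_2)=R_0(x,t_2)+\hbar R_1(x,t_2)+\hbar^2R_2(x,t_2),\qquad \lim_{t_1\to\alpha}A_{\mathrm{Gar}_{5/2+3/2},2}(x,t_1,t_2)=\frac{\beta x}{t_2(x-\beta)},$$ where $$R_0=x-\alpha+\frac{\alpha^2+32\alpha\beta-50\beta^2+45\delta}{18x}-\frac{18t_2+\beta(\alpha^2\beta+14\alpha\beta^2-32\beta^3-18\gamma^2+45\beta\delta)}{18\beta x^2}+\frac{t_2}{x^3},$$ $$R_1=\frac{(3x-\beta)\gamma}{2x^2(x-\beta)},\qquad R_2=\frac{5x^2+10x\beta-3\beta^2}{16x^2(x-\beta)^2}.$$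
   Context: **Hamiltonian system of type $5/2+3/2$ in $t_1$** ($t_2$ constant): $\hbar\,dq_i/dt_1=\partial H_1/\partial p_i$, $\hbar\,dp_i/dt_1=-\partial H_1/\partial q_i$ ($i=1,2$), with $$H_1=p_1^2-(q_1^2+t_1)p_1-2p_2q_1q_2-q_2-\frac{t_2}{q_2}.$$ **Laurent series solution.** This system has a convergent Laurent series solution at $t_1=\alpha$, containing the free parameters $(\alpha,\beta,\gamma,\delta)$ with $\beta\neq0$, of the form (write $s=t_1-\alpha$) $$q_1=\frac{\hbar}{s}-\frac{(\alpha-2\beta)s}{3\hbar}+\frac{\gamma s^2}{\hbar^2}+\frac{\delta s^3}{\hbar^3}-\frac{(3\alpha\gamma-10\beta\gamma+\alpha\hbar-2\beta\hbar)s^4}{9\hbar^4}+O(s^5),$$ $$\begin{aligned}q_2={}&\frac{\beta\hbar^2}{s^2}+\frac13(\alpha\beta-2\beta^2)-\frac{2\beta\gamma s}{3\hbar}+\frac{(\alpha^2\beta-4\alpha\beta^2+4\beta^3-9\beta\delta)s^2}{18\hbar^2}\\&+\frac{2(-2\alpha\beta\gamma+\alpha\beta\hbar-2\beta^2\hbar)s^3}{45\hbar^3}+O(s^4),\end{aligned}$$ $$p_1=\beta+\Bigl(\frac12+\frac{2\gamma}{\hbar}\Bigr)s+\frac{(\alpha^2-4\alpha\beta+4\beta^2+45\delta)s^2}{18\hbar^2}-\frac{(4\alpha\gamma-12\beta\gamma+\alpha\hbar-2\beta\hbar)s^3}{3\hbar^3}+O(s^4),$$ $$p_2=-\frac{s}{\hbar}-\frac{(4\gamma+\hbar)s^2}{4\beta\hbar^2}+\frac{2(\alpha-2\beta)s^3}{3\hbar^3}+\frac{(4\alpha\gamma-20\beta\gamma+\alpha\hbar-2\beta\hbar)s^4}{12\beta\hbar^4}+O(s^5).$$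 **Isomonodromy system.** Let $L=(L_{ij})$ be the $2\times2$ matrix with entries $$L_{11}=-L_{22}=q_1+\frac{p_2q_2}{x},\qquad L_{12}=x+p_1-q_1^2-t_1+\frac{q_2}{x},\qquad L_{21}=1-\frac{p_1}{x}+\frac{t_2}{q_2x^2},$$ and let $M_{2,12}=-q_2/t_2$ (the $(1,2)$-entry of the matrix $M_2$ in the deformation equation $\hbar\,\partial\Phi/\partial t_2=M_2\Phi$ of $\hbar\,\partial\Phi/\partial x=L\Phi$). **Schrödinger form.** Put $$P_1=-L_{11}-L_{22}-\frac{\hbar}{L_{12}}\frac{\partial L_{12}}{\partial x},\qquad P_2=L_{11}L_{22}-L_{12}L_{21}+\hbar\Bigl(-\frac{\partial L_{11}}{\partial x}+\frac{L_{11}}{L_{12}}\frac{\partial L_{12}}{\partial x}\Bigr),$$ $$Q_{\mathrm{Gar}_{5/2+3/2}}=-P_2+\frac{P_1^2}{4}+\frac{\hbar}{2}\frac{\partial P_1}{\partial x},\qquad A_{\mathrm{Gar}_{5/2+3/2},2}=\frac{M_{2,12}}{L_{12}}.$$ These are rational functions of $x$; the limits are taken for fixed $x\notin\{0,\beta\}$. *)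

(* Defs.v *)
From Stdlib Require Import Reals.
From Coquelicot Require Import Coquelicot.
Open Scope C_scope.

(* All variables (times, phase-space coordinates, spectral parameter x and the
   constants) are complex; derivatives are complex derivatives. *)

Definition H1 (t1 t2 q1 q2 p1 p2 : C) : C :=
  p1 ^ 2 - (q1 ^ 2 + t1) * p1 - 2 * p2 * q1 * q2 - q2 - t2 / q2.

(* Cinv is total, so the domain q2 <> 0 of H1 is stated explicitly; likewise
   C_derive is meaningful only at points of differentiability. *)
Definition hamilton_equations (hbar t2 : C) (q1 q2 p1 p2 : C -> C) (t : C)
  : Prop :=
  q2 t <> 0 /\
  (ex_derive q1 t /\ ex_derive q2 t /\ ex_derive p1 t /\ ex_derive p2 t) /\
  hbar * C_derive q1 t
    = C_derive (fun u => H1 t t2 (q1 t) (q2 t) u (p2 t)) (p1 t) /\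
  hbar * C_derive q2 t
    = C_derive (fun u => H1 t t2 (q1 t) (q2 t) (p1 t) u) (p2 t) /\
  hbar * C_derive p1 t
    = - C_derive (fun u => H1 t t2 u (q2 t) (p1 t) (p2 t)) (q1 t) /\
  hbar * C_derive p2 t
    = - C_derive (fun u => H1 t t2 (q1 t) u (p1 t) (p2 t)) (q2 t).

(* f(t) = head(s) + O(s^k) with s = t - alpha, where O(s^k) is the sum of a
   convergent power series in s of order at least k.  When head is a Laurent
   polynomial this is a convergent Laurent expansion of f at alpha. *)
Definition laurent_expansion (alpha : C) (f head : C -> C) (k : nat) : Prop :=
  exists c : nat -> C,
    locally' alpha (fun t : C =>
      is_series (fun n => c n * (t - alpha) ^ (n + k)) (f t - head (t - alpha))).

Definition q1_head (hbar alpha beta gamma delta s : C) : C :=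
  hbar / s - (alpha - 2 * beta) * s / (3 * hbar)
  + gamma * s ^ 2 / hbar ^ 2 + delta * s ^ 3 / hbar ^ 3
  - (3 * alpha * gamma - 10 * beta * gamma + alpha * hbar - 2 * beta * hbar)
      * s ^ 4 / (9 * hbar ^ 4).

Definition q2_head (hbar alpha beta gamma delta s : C) : C :=
  beta * hbar ^ 2 / s ^ 2 + 1 / 3 * (alpha * beta - 2 * beta ^ 2)
  - 2 * beta * gamma * s / (3 * hbar)
  + (alpha ^ 2 * beta - 4 * alpha * beta ^ 2 + 4 * beta ^ 3
       - 9 * beta * delta) * s ^ 2 / (18 * hbar ^ 2)
  + 2 * (- 2 * alpha * beta * gamma + alpha * beta * hbar
           - 2 * beta ^ 2 * hbar) * s ^ 3 / (45 * hbar ^ 3).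

Definition p1_head (hbar alpha beta gamma delta s : C) : C :=
  beta + (1 / 2 + 2 * gamma / hbar) * s
  + (alpha ^ 2 - 4 * alpha * beta + 4 * beta ^ 2 + 45 * delta)
      * s ^ 2 / (18 * hbar ^ 2)
  - (4 * alpha * gamma - 12 * beta * gamma + alpha * hbar - 2 * beta * hbar)
      * s ^ 3 / (3 * hbar ^ 3).

Definition p2_head (hbar alpha beta gamma s : C) : C :=
  - s / hbar - (4 * gamma + hbar) * s ^ 2 / (4 * beta * hbar ^ 2)
  + 2 * (alpha - 2 * beta) * s ^ 3 / (3 * hbar ^ 3)
  + (4 * alpha * gamma - 20 * beta * gamma + alpha * hbar - 2 * beta * hbar)
      * s ^ 4 / (12 * beta * hbar ^ 4).

Definition laurent_solution (hbar t2 alpha beta gamma delta : C)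
    (q1 q2 p1 p2 : C -> C) : Prop :=
  locally' alpha (hamilton_equations hbar t2 q1 q2 p1 p2) /\
  laurent_expansion alpha q1 (q1_head hbar alpha beta gamma delta) 5 /\
  laurent_expansion alpha q2 (q2_head hbar alpha beta gamma delta) 4 /\
  laurent_expansion alpha p1 (p1_head hbar alpha beta gamma delta) 4 /\
  laurent_expansion alpha p2 (p2_head hbar alpha beta gamma) 5.

(* Entries of the matrix L at (t1, t2) and the phase point (q1, q2, p1, p2). *)
Definition L11 (t1 t2 q1 q2 p1 p2 x : C) : C := q1 + p2 * q2 / x.
Definition L12 (t1 t2 q1 q2 p1 p2 x : C) : C :=
  x + p1 - q1 ^ 2 - t1 + q2 / x.
Definition L21 (t1 t2 q1 q2 p1 p2 x : C) : C :=
  1 - p1 / x + t2 / (q2 * x ^ 2).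
Definition L22 (t1 t2 q1 q2 p1 p2 x : C) : C := - L11 t1 t2 q1 q2 p1 p2 x.

Definition M2_12 (t2 q2 : C) : C := - q2 / t2.

Definition P1 (hbar t1 t2 q1 q2 p1 p2 x : C) : C :=
  let l11 := L11 t1 t2 q1 q2 p1 p2 in
  let l12 := L12 t1 t2 q1 q2 p1 p2 in
  let l22 := L22 t1 t2 q1 q2 p1 p2 in
  - l11 x - l22 x - hbar / l12 x * C_derive l12 x.

Definition P2 (hbar t1 t2 q1 q2 p1 p2 x : C) : C :=
  let l11 := L11 t1 t2 q1 q2 p1 p2 in
  let l12 := L12 t1 t2 q1 q2 p1 p2 in
  let l21 := L21 t1 t2 q1 q2 p1 p2 in
  let l22 := L22 t1 t2 q1 q2 p1 p2 in
  l11 x * l22 x - l12 x * l21 x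
  + hbar * (- C_derive l11 x + l11 x / l12 x * C_derive l12 x).

Definition Q_Gar (hbar t1 t2 q1 q2 p1 p2 x : C) : C :=
  - P2 hbar t1 t2 q1 q2 p1 p2 x
  + P1 hbar t1 t2 q1 q2 p1 p2 x ^ 2 / 4
  + hbar / 2 * C_derive (P1 hbar t1 t2 q1 q2 p1 p2) x.

Definition A_Gar2 (t1 t2 q1 q2 p1 p2 x : C) : C :=
  M2_12 t2 q2 / L12 t1 t2 q1 q2 p1 p2 x.

(* R_0, R_1 and R_2 in the limit of Q; Stdlib already uses R0 and R1. *)
Definition limQ0 (alpha beta gamma delta x t2 : C) : C :=
  x - alpha
  + (alpha ^ 2 + 32 * alpha * beta - 50 * beta ^ 2 + 45 * delta) / (18 * x)
  - (18 * t2
     + beta * (alpha ^ 2 * beta + 14 * alpha * beta ^ 2 - 32 * beta ^ 3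
               - 18 * gamma ^ 2 + 45 * beta * delta))
      / (18 * beta * x ^ 2)
  + t2 / x ^ 3.

Definition limQ1 (beta gamma x : C) : C :=
  (3 * x - beta) * gamma / (2 * x ^ 2 * (x - beta)).

Definition limQ2 (beta x : C) : C :=
  (5 * x ^ 2 + 10 * x * beta - 3 * beta ^ 2)
    / (16 * x ^ 2 * (x - beta) ^ 2).

(* Main.v *)
Require Import Defs.
From Stdlib Require Import Reals Lra.
From Coquelicot Require Import Coquelicot.
Open Scope C_scope.

(** Only the first few Laurent coefficients matter.  With [s = t1 - alpha], the
expansions can be written [q1 = hbar / s + s U], [q2 = beta hbar^2 / s^2 + V],
[p1 = beta + p11 s + s^2 Y] and [p2 = s (w0 + w1 s + s^2 W)], where [U], [V],
[Y], [W] have finite limits as [s -> 0].  In these variables [s L11] and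
[s^2 L12] are polynomials in [s, U, V, Y, W], the singular parts of [Q] cancel
identically, and [Q] becomes a rational function of [s, U, V, Y, W] whose
denominator at [s = 0] is a power of [hbar^2 (beta - x) / x] up to a nonzero
factor.  The limit is therefore obtained by substituting [s = 0]. *)

(** * Limits and neighbourhoods in [C], expressed through the modulus *)

Lemma filterlim_C_Cmod {T : Type} (F : (T -> Prop) -> Prop) {FF : Filter F}
    (f : T -> C) (l : C) :
  filterlim f F (locally l) <->
  forall eps : R, (0 < eps)%R -> F (fun t => (Cmod (f t - l) < eps)%R).
Proof.
split.
- intros H eps Heps.
  apply (H (fun y => (Cmod (y - l) < eps)%R)).
  apply (locally_le_locally_norm (V := C_NormedModule) l).
  exists (mkposreal eps Heps). intros y Hy. exact Hy.
- intros H P HP.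
  destruct (locally_norm_le_locally (V := C_NormedModule) l P HP) as [eps He].
  generalize (H eps (cond_pos eps)). unfold filtermap. apply filter_imp.
  intros t Ht. apply He. exact Ht.
Qed.

Lemma locally'_C_Cmod (a : C) (P : C -> Prop) :
  locally' a P <->
  exists d : R, (0 < d)%R /\
    forall t : C, t <> a -> (Cmod (t - a) < d)%R -> P t.
Proof.
split.
- intros H.
  destruct (locally_norm_le_locally (V := C_NormedModule) a _ H) as [d Hd].
  exists d. split; [apply cond_pos|].
  intros t Hta Ht. exact (Hd t Ht Hta).
- intros [d [Hd H]].
  apply (locally_le_locally_norm (V := C_NormedModule) a).
  exists (mkposreal d Hd). intros y Hy Hya. now apply H.
Qed.

Lemma filterlim_C_const {T : Type} (F : (T -> Prop) -> Prop) {FF : Filter F}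
    (c : C) : filterlim (fun _ : T => c) F (locally c).
Proof. apply filterlim_const. Qed.

Lemma filterlim_C_plus {T : Type} (F : (T -> Prop) -> Prop) {FF : Filter F}
    (f g : T -> C) (a b : C) :
  filterlim f F (locally a) -> filterlim g F (locally b) ->
  filterlim (fun t => f t + g t) F (locally (a + b)).
Proof.
intros Hf Hg.
exact (filterlim_comp_2 _ _ _ Hf Hg (filterlim_plus (V := C_NormedModule) a b)).
Qed.

Lemma filterlim_C_opp {T : Type} (F : (T -> Prop) -> Prop) {FF : Filter F}
    (f : T -> C) (a : C) :
  filterlim f F (locally a) -> filterlim (fun t => - f t) F (locally (- a)).
Proof.
intros Hf.
exact (filterlim_comp _ _ _ _ _ _ _ _ Hf
         (filterlim_opp (V := C_NormedModule) a)).
Qed.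

Lemma filterlim_C_minus {T : Type} (F : (T -> Prop) -> Prop) {FF : Filter F}
    (f g : T -> C) (a b : C) :
  filterlim f F (locally a) -> filterlim g F (locally b) ->
  filterlim (fun t => f t - g t) F (locally (a - b)).
Proof.
intros Hf Hg. apply filterlim_C_plus; [exact FF|exact Hf|].
now apply filterlim_C_opp.
Qed.

Lemma filterlim_C_mult {T : Type} (F : (T -> Prop) -> Prop) {FF : Filter F}
    (f g : T -> C) (a b : C) :
  filterlim f F (locally a) -> filterlim g F (locally b) ->
  filterlim (fun t => f t * g t) F (locally (a * b)).
Proof.
intros Hf Hg.
(* Multiplication is known to be continuous for the uniform structure of the absolute ring
   [C_AbsRing]; [locally_C] says that it has the same neighbourhoods as the product structure on
   [C]. *)
intros P HP. apply locally_C in HP. revert P HP.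
apply (filterlim_comp_2 (G := locally (T := AbsRing_UniformSpace C_AbsRing) a)
  (H := locally (T := AbsRing_UniformSpace C_AbsRing) b) f g Cmult).
- intros P HP. apply Hf. now apply locally_C.
- intros P HP. apply Hg. now apply locally_C.
- apply (filterlim_mult (K := C_AbsRing)).
Qed.

Lemma filterlim_C_pow {T : Type} (F : (T -> Prop) -> Prop) {FF : Filter F}
    (f : T -> C) (a : C) (n : nat) :
  filterlim f F (locally a) -> filterlim (fun t => f t ^ n) F (locally (a ^ n)).
Proof.
intros Hf. induction n as [|n IH]; simpl.
- now apply filterlim_C_const.
- now apply filterlim_C_mult.
Qed.

Lemma filterlim_C_Cmod_gt {T : Type} (F : (T -> Prop) -> Prop) {FF : Filter F}
    (f : T -> C) (a : C) :
  filterlim f F (locally a) -> a <> 0 ->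
  F (fun t => (Cmod a / 2 < Cmod (f t))%R).
Proof.
intros Hf Ha. apply Cmod_gt_0 in Ha.
assert (Ha2 : (0 < Cmod a / 2)%R) by lra.
generalize (proj1 (filterlim_C_Cmod F f a) Hf _ Ha2). apply filter_imp.
intros t Ht.
assert (H := Cmod_triangle (f t) (- (f t - a))).
rewrite Cmod_opp in H.
replace (f t + - (f t - a)) with a in H by ring. lra.
Qed.

Lemma Cmod_gt_neq0 (z : C) (r : R) : (0 <= r)%R -> (r < Cmod z)%R -> z <> 0.
Proof. intros H0 H E. rewrite E, Cmod_0 in H. lra. Qed.

Lemma filterlim_C_inv {T : Type} (F : (T -> Prop) -> Prop) {FF : Filter F}
    (f : T -> C) (a : C) :
  filterlim f F (locally a) -> a <> 0 ->
  filterlim (fun t => / f t) F (locally (/ a)).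
Proof.
intros Hf Ha. apply filterlim_C_Cmod; [exact FF|]. intros eps Heps.
assert (Ha' := proj1 (Cmod_gt_0 a) Ha).
(* The tolerance comes from [|1 / f t - 1 / a| = |f t - a| / (|f t| |a|)] together with
   [|f t| > |a| / 2] near the limit. *)
assert (Hd : (0 < eps * (Cmod a / 2 * Cmod a))%R).
{ apply Rmult_lt_0_compat; [lra|]. apply Rmult_lt_0_compat; lra. }
generalize (filter_and _ _ (proj1 (filterlim_C_Cmod F f a) Hf _ Hd)
  (filterlim_C_Cmod_gt F f a Hf Ha)).
apply filter_imp. intros t [H1 H2].
assert (Hft : f t <> 0) by (apply (Cmod_gt_neq0 _ (Cmod a / 2)); lra).
replace (/ f t - / a) with (- (f t - a) / (f t * a)) by (field; now split).
rewrite Cmod_div by (now apply Cmult_neq_0).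
rewrite Cmod_opp, Cmod_mult.
assert (Hp : (Cmod a / 2 * Cmod a < Cmod (f t) * Cmod a)%R)
  by (apply Rmult_lt_compat_r; lra).
assert (Hp0 : (0 < Cmod a / 2 * Cmod a)%R) by (apply Rmult_lt_0_compat; lra).
apply Rlt_div_l; [lra|].
eapply Rlt_trans; [exact H1|]. now apply Rmult_lt_compat_l.
Qed.

Lemma filterlim_C_div {T : Type} (F : (T -> Prop) -> Prop) {FF : Filter F}
    (f g : T -> C) (a b : C) :
  filterlim f F (locally a) -> filterlim g F (locally b) -> b <> 0 ->
  filterlim (fun t => f t / g t) F (locally (a / b)).
Proof.
intros Hf Hg Hb. apply filterlim_C_mult; [exact FF|exact Hf|].
now apply filterlim_C_inv.
Qed.

Lemma filterlim_C_id (a : C) : filterlim (fun t => t) (locally' a) (locally a).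
Proof.
intros P HP. now apply filter_le_within.
Qed.

Lemma locally'_C_neq (a : C) : locally' a (fun t => t - a <> 0).
Proof.
apply locally'_C_Cmod. exists 1%R. split; [lra|].
intros t Ht _ E. apply Ht. replace t with (t - a + a) by ring.
rewrite E. ring.
Qed.

(** Follows the syntax of the function. Constants come before the operations, so subterms free of
    the variable stay whole. Goals it cannot treat, in particular nonvanishing of denominators, are
    left open. *)
Ltac clim :=
  first [ eassumption | clim_step; clim | idtac ]
with clim_step :=
  lazymatch goal with
  | |- Filter _ => typeclasses eauto
  | |- ProperFilter _ => typeclasses eauto
  | |- filterlim (fun _ => ?c) _ _ => apply filterlim_C_const
  | |- filterlim (fun t => t) _ _ => apply filterlim_C_id
  | |- filterlim (fun t => @?f t + @?g t) _ _ => eapply (filterlim_C_plus _ f g)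
  | |- filterlim (fun t => @?f t - @?g t) _ _ => eapply (filterlim_C_minus _ f g)
  | |- filterlim (fun t => - @?f t) _ _ => eapply (filterlim_C_opp _ f)
  | |- filterlim (fun t => @?f t * @?g t) _ _ => eapply (filterlim_C_mult _ f g)
  | |- filterlim (fun t => @?f t / @?g t) _ _ => eapply (filterlim_C_div _ f g)
  | |- filterlim (fun t => @?f t ^ ?n) _ _ => eapply (filterlim_C_pow _ f _ n)
  end.

(** The separate equation [a = b] lets [clim] produce the limit in whatever form the syntax
    dictates; algebra then compares it with the wanted value. *)
Lemma filterlim_C_ext {T : Type} (F : (T -> Prop) -> Prop) {FF : Filter F}
    (f g : T -> C) (a b : C) :
  filterlim f F (locally a) -> F (fun t => f t = g t) -> a = b ->
  filterlim g F (locally b).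
Proof.
intros Hf Hfg <-. exact (filterlim_ext_loc f g Hfg Hf).
Qed.

(** * Bounds on convergent series and remainders of Laurent expansions *)

Lemma is_series_C_terms_bounded (a : nat -> C) (l : C) :
  is_series a l -> exists M : R, forall n, (Cmod (a n) <= M)%R.
Proof.
intros H.
destruct (filterlim_bounded (V := C_NormedModule) (sum_n a)
            (ex_intro _ l H)) as [M HM].
(* A term of positive index is a difference of two consecutive partial sums, each bounded by [M]. *)
exists (M + M)%R. intros [|n].
- assert (H0 := HM O). rewrite sum_O in H0.
  change (norm (a O)) with (Cmod (a O)) in H0.
  assert (H1 := Cmod_ge_0 (a O)). lra.
- assert (H0 := HM n). assert (H1 := HM (S n)). rewrite sum_Sn in H1.
  change (Cmod (sum_n a n) <= M)%R in H0.
  change (Cmod (sum_n a n + a (S n)) <= M)%R in H1.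
  assert (H2 := Cmod_triangle (sum_n a n + a (S n)) (- sum_n a n)).
  rewrite Cmod_opp in H2.
  replace (sum_n a n + a (S n) + - sum_n a n) with (a (S n)) in H2 by ring.
  lra.
Qed.

Lemma is_series_C_geometric_bound (a : nat -> C) (l : C) (B q : R) :
  is_series a l -> (0 <= q <= / 2)%R ->
  (forall n, (Cmod (a n) <= B * q ^ n)%R) -> (Cmod l <= 2 * B)%R.
Proof.
intros H [Hq0 Hq] Ha.
assert (HB : (0 <= B)%R).
{ assert (H0 := Ha O). simpl in H0. assert (H1 := Cmod_ge_0 (a O)). lra. }
(* The right side is the exact sum of [B / 2 ^ j] over [j <= n]. Keeping the subtracted term is what
   makes the induction close. *)
assert (Hs : forall n, (Cmod (sum_n a n) <= 2 * B - B * (/ 2) ^ n)%R).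
{ assert (Hp : forall n, (Cmod (a n) <= B * (/ 2) ^ n)%R).
  { intros n. eapply Rle_trans; [apply Ha|].
    apply Rmult_le_compat_l; [exact HB|]. apply pow_incr. lra. }
  induction n as [|n IH].
  - rewrite sum_O. specialize (Hp O). simpl in *. lra.
  - rewrite sum_Sn.
    eapply Rle_trans; [apply Cmod_triangle|].
    assert (H1 := Hp (S n)). simpl in *. lra. }
apply Rnot_lt_le. intros Hl.
assert (He : (0 < Cmod l - 2 * B)%R) by lra.
destruct (proj1 (filterlim_C_Cmod eventually (sum_n a) l) H _ He) as [N HN].
specialize (HN N (Nat.le_refl _)). specialize (Hs N).
assert (Hn : (0 <= B * (/ 2) ^ N)%R).
{ apply Rmult_le_pos; [exact HB|]. apply pow_le. lra. }
assert (Ht := Cmod_triangle (sum_n a N) (- (sum_n a N - l))).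
rewrite Cmod_opp in Ht.
replace (sum_n a N + - (sum_n a N - l)) with l in Ht by ring. lra.
Qed.

(* The terms at one point [t0 <> alpha] are bounded, which dominates the series
at [t] by a geometric one of ratio [|t - alpha| / |t0 - alpha| <= 1/2]. *)
Lemma laurent_expansion_remainder (alpha : C) (f head : C -> C) (k : nat) :
  laurent_expansion alpha f head (S k) ->
  filterlim (fun t => (f t - head (t - alpha)) / (t - alpha) ^ k)
    (locally' alpha) (locally (RtoC 0)).
Proof.
intros [c Hc].
apply locally'_C_Cmod in Hc. destruct Hc as [d [Hd Hc]].
(* Any point inside the punctured disc of convergence would do; half the radius leaves room for
   ratio at most 1/2 on the disc of radius [d / 4]. *)
set (t0 := alpha + RtoC (d / 2)).
assert (Et0 : t0 - alpha = RtoC (d / 2)) by (unfold t0; ring).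
assert (Hd0 : RtoC (d / 2) <> 0).
{ intros E. apply RtoC_inj in E. lra. }
assert (Hm : Cmod (RtoC (d / 2)) = (d / 2)%R).
{ rewrite Cmod_R, Rabs_pos_eq; lra. }
destruct (is_series_C_terms_bounded _ _
  (Hc t0 ltac:(intros E; apply Hd0; rewrite <- Et0, E; ring)
     ltac:(rewrite Et0, Hm; lra))) as [M HM].
rewrite Et0 in HM.
assert (HM0 : (0 <= M)%R).
{ eapply Rle_trans; [apply Cmod_ge_0|apply (HM O)]. }
assert (Hdk : (0 < (d / 2) ^ S k)%R) by (apply pow_lt; lra).
(* With [q = |s| / (d / 2)] the term of index [n] is at most [M * q ^ S k * q ^ n], so the sum is at
   most [2 * M * q ^ S k = K * |s| ^ S k]. Dividing by [s ^ k] leaves one factor [|s|], which forces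
   the limit 0. *)
set (K := (2 * M / (d / 2) ^ S k)%R).
assert (HK : (0 <= K)%R).
{ unfold K. apply Rmult_le_pos; [lra|]. left. now apply Rinv_0_lt_compat. }
assert (Hb : forall t : C, t <> alpha -> (Cmod (t - alpha) < d / 4)%R ->
  (Cmod ((f t - head (t - alpha)) / (t - alpha) ^ k)%C
     <= K * Cmod (t - alpha)%C)%R).
{ intros t Hta Ht.
  assert (Hs : t - alpha <> 0).
  { intros E. apply Hta. replace t with (t - alpha + alpha) by ring.
    rewrite E. ring. }
  assert (Hser := Hc t Hta ltac:(lra)).
  set (s := t - alpha) in *.
  assert (Hs0 := proj1 (Cmod_gt_0 s) Hs).
  set (q := (Cmod s / (d / 2))%R).
  assert (Hq : (0 <= q <= / 2)%R).
  { unfold q. split.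
    - apply Rmult_le_pos; [lra|]. left. apply Rinv_0_lt_compat. lra.
    - apply Rle_div_l; lra. }
  assert (Hl := is_series_C_geometric_bound _ _ (M * q ^ S k) q Hser Hq).
  assert (Hpow : (Cmod s ^ S k = q ^ S k * (d / 2) ^ S k)%R).
  { rewrite <- Rpow_mult_distr. f_equal. unfold q. field. lra. }
  rewrite Cmod_div by (now apply Cpow_nz).
  rewrite Cmod_pow.
  assert (Hsk : (0 < Cmod s ^ k)%R) by (now apply pow_lt).
  apply Rle_div_l; [exact Hsk|].
  replace (K * Cmod s * Cmod s ^ k)%R with (2 * (M * q ^ S k))%R.
  2:{ replace (K * Cmod s * Cmod s ^ k)%R with (K * Cmod s ^ S k)%R
        by (simpl; ring).
      rewrite Hpow. unfold K. field. lra. }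
  apply Hl. intros n.
  rewrite Cmod_mult, Cmod_pow.
  specialize (HM n). rewrite Cmod_mult, Cmod_pow, Hm in HM.
  replace (Cmod s ^ (n + S k))%R
    with ((d / 2) ^ (n + S k) * q ^ (n + S k))%R.
  2:{ rewrite <- Rpow_mult_distr. f_equal. unfold q. field. lra. }
  rewrite (pow_add q), <- Rmult_assoc.
  replace (M * q ^ S k * q ^ n)%R with (M * (q ^ n * q ^ S k))%R by ring.
  apply Rmult_le_compat_r; [|exact HM].
  apply Rmult_le_pos; apply pow_le; lra. }
apply filterlim_C_Cmod; [typeclasses eauto|]. intros eps Heps.
apply locally'_C_Cmod.
(* [K + 1] replaces [K], which may be zero. *)
exists (Rmin (d / 4) (eps / (K + 1))).
assert (Hek : (0 < eps / (K + 1))%R) by (apply Rdiv_lt_0_compat; lra).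
split; [apply Rmin_glb_lt; lra|].
intros t Hta Ht.
assert (H1 := Rmin_l (d / 4) (eps / (K + 1))).
assert (H2 := Rmin_r (d / 4) (eps / (K + 1))).
replace ((f t - head (t - alpha)) / (t - alpha) ^ k - 0)
  with ((f t - head (t - alpha)) / (t - alpha) ^ k) by ring.
eapply Rle_lt_trans; [apply Hb; [exact Hta|lra]|].
assert (H3 : (Cmod (t - alpha) * (K + 1) < eps)%R).
{ apply Rlt_div_r; lra. }
assert (H4 := Cmod_ge_0 (t - alpha)). lra.
Qed.

(** * Nonvanishing, derivatives in [x], and a closed form of [Q_Gar] *)

Lemma Cdiv_neq_0 (a b : C) : a <> 0 -> b <> 0 -> a / b <> 0.
Proof.
intros Ha Hb E. apply Ha. replace a with (a / b * b) by (field; exact Hb).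
rewrite E. ring.
Qed.

Ltac cneq :=
  try assumption;
  lazymatch goal with
  | |- _ * _ <> _ => apply Cmult_neq_0; cneq
  | |- _ / _ <> _ => apply Cdiv_neq_0; cneq
  | |- _ ^ _ <> _ => apply Cpow_nz; cneq
  | |- _ - _ <> _ => apply Cminus_eq_contra; auto
  | |- RtoC _ <> _ => let E := fresh in intros E; apply RtoC_inj in E; lra
  end.

Lemma filterlim_C_neq0 {T : Type} (F : (T -> Prop) -> Prop)
    {FF : Filter F} (f : T -> C) (a : C) :
  filterlim f F (locally a) -> a <> 0 -> F (fun t => f t <> 0).
Proof.
intros Hf Ha. generalize (filterlim_C_Cmod_gt F f a Hf Ha). apply filter_imp.
intros t. apply Cmod_gt_neq0. assert (H := Cmod_ge_0 a). lra.
Qed.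

Lemma locally'_C_neq0 (x : C) : x <> 0 -> locally' x (fun y : C => y <> 0).
Proof.
intros Hx. apply (filterlim_C_neq0 (locally' x) (fun y : C => y) x);
  [apply filterlim_C_id|exact Hx].
Qed.

(** Off [z] the difference quotient is [g], so its limit is that of [g]. For rational functions the
    factor [y - z] splits off by algebra, which reduces each derivative to a [field] identity and a
    termwise limit. *)
Lemma C_derive_slope (f g : C -> C) (z l : C) :
  locally' z (fun y : C => f y - f z = g y * (y - z)) ->
  filterlim g (locally' z) (locally l) -> C_derive f z = l.
Proof.
intros Hfg Hg. apply is_C_lim_unique.
apply (filterlim_C_ext (locally' z) g _ l l Hg); [|reflexivity].
generalize (filter_and _ _ Hfg (locally'_C_neq z)). apply filter_imp.
intros y [H1 H2]. rewrite H1. field. exact H2.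
Qed.

Lemma C_derive_L11 (t1 t2 q1 q2 p1 p2 x : C) : x <> 0 ->
  C_derive (L11 t1 t2 q1 q2 p1 p2) x = - (p2 * q2) / x ^ 2.
Proof.
intros Hx.
apply (C_derive_slope _ (fun y : C => - (p2 * q2) / (x * y))).
- generalize (locally'_C_neq0 x Hx). apply filter_imp.
  intros y Hy. unfold L11. field. now split.
- replace (x ^ 2) with (x * x) by ring. clim; cneq.
Qed.

Lemma C_derive_L12 (t1 t2 q1 q2 p1 p2 x : C) : x <> 0 ->
  C_derive (L12 t1 t2 q1 q2 p1 p2) x = 1 - q2 / x ^ 2.
Proof.
intros Hx.
apply (C_derive_slope _ (fun y : C => 1 - q2 / (x * y))).
- generalize (locally'_C_neq0 x Hx). apply filter_imp.
  intros y Hy. unfold L12. field. now split.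
- replace (x ^ 2) with (x * x) by ring. clim; cneq.
Qed.

(** [L] has trace zero, so only the logarithmic derivative of [L12] survives. *)
Lemma P1_eq (hbar t1 t2 q1 q2 p1 p2 x : C) : x <> 0 ->
  P1 hbar t1 t2 q1 q2 p1 p2 x
  = - hbar * (1 - q2 / x ^ 2) / L12 t1 t2 q1 q2 p1 p2 x.
Proof.
intros Hx. unfold P1, L22. rewrite C_derive_L12 by exact Hx.
unfold Cdiv. ring.
Qed.

Lemma C_derive_P1 (hbar t1 t2 q1 q2 p1 p2 x : C) :
  x <> 0 -> L12 t1 t2 q1 q2 p1 p2 x <> 0 ->
  C_derive (P1 hbar t1 t2 q1 q2 p1 p2) x
  = - hbar * (2 * q2 / x ^ 3 / L12 t1 t2 q1 q2 p1 p2 x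
              - (1 - q2 / x ^ 2) ^ 2 / L12 t1 t2 q1 q2 p1 p2 x ^ 2).
Proof.
intros Hx Hl.
set (l := L12 t1 t2 q1 q2 p1 p2) in *.
assert (Hlim : filterlim l (locally' x) (locally (l x))).
{ unfold l, L12. clim. }
(* This is the quotient rule before passing to the limit: the slope of [1 - q2 / y ^ 2] over [l y],
   minus the numerator at [x] times the slope of [l] over [l x * l y]. *)
apply (C_derive_slope _ (fun y : C => - hbar *
  (q2 * (x + y) / (x ^ 2 * y ^ 2) / l y
   - (1 - q2 / x ^ 2) * (1 - q2 / (x * y)) / (l x * l y)))).
- generalize (filter_and _ _ (locally'_C_neq0 x Hx)
    (filterlim_C_neq0 _ _ _ Hlim Hl)).
  apply filter_imp. intros y [Hy Hly].
  rewrite !P1_eq by assumption. fold l.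
  transitivity (- hbar * ((q2 / x ^ 2 - q2 / y ^ 2) / l y
     - (1 - q2 / x ^ 2) * (l y - l x) / (l x * l y))).
  { field. repeat split; assumption. }
  replace (l y - l x) with ((1 - q2 / (x * y)) * (y - x))
    by (unfold l, L12; field; now split).
  field. repeat split; assumption.
(* The function is kept; only the form of the limit changes. *)
- match goal with |- filterlim ?f _ _ =>
    eapply (filterlim_C_ext _ f f)
  end.
  + clim; cneq.
  + apply filter_forall. reflexivity.
  + field. now split.
Qed.

(** The coefficient 3/4 is 1/4 from [P1 ^ 2 / 4] plus 1/2 from the derivative of [P1]. The terms are
    grouped by the explicit powers of [hbar], because each group turns out to be regular at
    [t1 = alpha] by itself. *)
Lemma Q_Gar_eq (hbar t1 t2 q1 q2 p1 p2 x : C) :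
  x <> 0 -> L12 t1 t2 q1 q2 p1 p2 x <> 0 ->
  Q_Gar hbar t1 t2 q1 q2 p1 p2 x
  = L11 t1 t2 q1 q2 p1 p2 x ^ 2
    + L12 t1 t2 q1 q2 p1 p2 x * L21 t1 t2 q1 q2 p1 p2 x
    - hbar * (p2 * q2 / x ^ 2
        + L11 t1 t2 q1 q2 p1 p2 x * (1 - q2 / x ^ 2)
          / L12 t1 t2 q1 q2 p1 p2 x)
    + hbar ^ 2 * (3 / 4 * ((1 - q2 / x ^ 2) / L12 t1 t2 q1 q2 p1 p2 x) ^ 2
        - q2 / x ^ 3 / L12 t1 t2 q1 q2 p1 p2 x).
Proof.
intros Hx Hl. unfold Q_Gar. rewrite C_derive_P1, P1_eq by assumption.
unfold P2, L22. rewrite C_derive_L11, C_derive_L12 by assumption.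
field. now split.
Qed.

(** * Limits of the bounded parts of the Laurent solution *)

Lemma q1_second_order (hbar alpha beta gamma delta : C) (q1 : C -> C) :
  hbar <> 0 ->
  laurent_expansion alpha q1 (q1_head hbar alpha beta gamma delta) 5 ->
  filterlim (fun t : C => (q1 t - hbar / (t - alpha)) / (t - alpha))
    (locally' alpha) (locally (- (alpha - 2 * beta) / (3 * hbar))).
Proof.
intros Hh H. apply laurent_expansion_remainder in H.
(* Everything after the constant is [t - alpha] times a factor with a finite limit. The last summand
   is the remainder divided by its fourth power of [t - alpha], which tends to 0. The next three
   lemmas use the same rearrangement. *)
eapply (filterlim_C_ext (locally' alpha)
  (fun t : C => - (alpha - 2 * beta) / (3 * hbar)
   + (t - alpha) * (gamma / hbar ^ 2 + delta * (t - alpha) / hbar ^ 3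
      - (3 * alpha * gamma - 10 * beta * gamma + alpha * hbar
         - 2 * beta * hbar) * (t - alpha) ^ 2 / (9 * hbar ^ 4)
      + (t - alpha) ^ 2 * ((q1 t - q1_head hbar alpha beta gamma delta
           (t - alpha)) / (t - alpha) ^ 4)))).
- clim; cneq.
- generalize (locally'_C_neq alpha). apply filter_imp. intros t Hs.
  unfold q1_head. field. now split.
- unfold Cdiv. ring.
Qed.

Lemma q2_second_order (hbar alpha beta gamma delta : C) (q2 : C -> C) :
  hbar <> 0 ->
  laurent_expansion alpha q2 (q2_head hbar alpha beta gamma delta) 4 ->
  filterlim (fun t : C => q2 t - beta * hbar ^ 2 / (t - alpha) ^ 2)
    (locally' alpha) (locally ((alpha * beta - 2 * beta ^ 2) / 3)).
Proof.
intros Hh H. apply laurent_expansion_remainder in H.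
eapply (filterlim_C_ext (locally' alpha)
  (fun t : C => (alpha * beta - 2 * beta ^ 2) / 3
   + (t - alpha) * (- (2 * beta * gamma) / (3 * hbar)
      + (alpha ^ 2 * beta - 4 * alpha * beta ^ 2 + 4 * beta ^ 3
       - 9 * beta * delta) * (t - alpha) / (18 * hbar ^ 2)
      + 2 * (- 2 * alpha * beta * gamma + alpha * beta * hbar
           - 2 * beta ^ 2 * hbar) * (t - alpha) ^ 2 / (45 * hbar ^ 3)
      + (t - alpha) ^ 2 * ((q2 t - q2_head hbar alpha beta gamma delta
           (t - alpha)) / (t - alpha) ^ 3)))).
- clim; cneq.
- generalize (locally'_C_neq alpha). apply filter_imp. intros t Hs.
  unfold q2_head. field. now split.
- unfold Cdiv. ring.
Qed.

Lemma p1_second_order (hbar alpha beta gamma delta : C) (p1 : C -> C) :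
  hbar <> 0 ->
  laurent_expansion alpha p1 (p1_head hbar alpha beta gamma delta) 4 ->
  filterlim (fun t : C => (p1 t - beta - (1 / 2 + 2 * gamma / hbar) * (t - alpha))
      / (t - alpha) ^ 2)
    (locally' alpha)
    (locally ((alpha ^ 2 - 4 * alpha * beta + 4 * beta ^ 2 + 45 * delta)
      / (18 * hbar ^ 2))).
Proof.
intros Hh H. apply laurent_expansion_remainder in H.
eapply (filterlim_C_ext (locally' alpha)
  (fun t : C => (alpha ^ 2 - 4 * alpha * beta + 4 * beta ^ 2 + 45 * delta)
      / (18 * hbar ^ 2)
   + (t - alpha) * (- (4 * alpha * gamma - 12 * beta * gamma + alpha * hbar
        - 2 * beta * hbar) / (3 * hbar ^ 3)
      + ((p1 t - p1_head hbar alpha beta gamma delta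
           (t - alpha)) / (t - alpha) ^ 3)))).
- clim; cneq.
- generalize (locally'_C_neq alpha). apply filter_imp. intros t Hs.
  unfold p1_head. field. now split.
- unfold Cdiv. ring.
Qed.

Lemma p2_second_order (hbar alpha beta gamma : C) (p2 : C -> C) :
  hbar <> 0 -> beta <> 0 ->
  laurent_expansion alpha p2 (p2_head hbar alpha beta gamma) 5 ->
  filterlim (fun t : C => (p2 t / (t - alpha) + 1 / hbar
        + (4 * gamma + hbar) / (4 * beta * hbar ^ 2) * (t - alpha))
      / (t - alpha) ^ 2)
    (locally' alpha)
    (locally (2 * (alpha - 2 * beta) / (3 * hbar ^ 3))).
Proof.
intros Hh Hb H. apply laurent_expansion_remainder in H.
eapply (filterlim_C_ext (locally' alpha)
  (fun t : C => 2 * (alpha - 2 * beta) / (3 * hbar ^ 3)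
   + (t - alpha) * ((4 * alpha * gamma - 20 * beta * gamma + alpha * hbar
        - 2 * beta * hbar) / (12 * beta * hbar ^ 4)
      + ((p2 t - p2_head hbar alpha beta gamma
           (t - alpha)) / (t - alpha) ^ 4)))).
- clim; cneq.
- generalize (locally'_C_neq alpha). apply filter_imp. intros t Hs.
  unfold p2_head. field. repeat split; assumption.
- unfold Cdiv. ring.
Qed.


(** * Rescaled variables and cancellation of the poles *)

Definition q1_blowup (hbar s U : C) : C := hbar / s + s * U.
Definition q2_blowup (hbar beta s V : C) : C := beta * hbar ^ 2 / s ^ 2 + V.
Definition p1_blowup (hbar beta gamma s Y : C) : C :=
  beta + (1 / 2 + 2 * gamma / hbar) * s + s ^ 2 * Y.
Definition p2_blowup (hbar beta gamma s W : C) : C :=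
  s * (- 1 / hbar - (4 * gamma + hbar) / (4 * beta * hbar ^ 2) * s
       + s ^ 2 * W).

(** The coefficient of [s ^ (-2)] in [L12]: [- q1 ^ 2] contributes [- hbar ^ 2] and [q2 / x]
    contributes [beta * hbar ^ 2 / x]. No simple pole occurs, since [q1] has no constant term and
    [q2] no term in [1 / s]. *)
Definition L12_pole (hbar beta x : C) : C := hbar ^ 2 * (beta - x) / x.
Definition L12_rest (hbar alpha beta gamma x s U V Y : C) : C :=
  x + p1_blowup hbar beta gamma s Y - alpha - s - 2 * hbar * U
  - s ^ 2 * U ^ 2 + V / x.
Definition L12_reg (hbar alpha beta gamma x s U V Y : C) : C :=
  L12_pole hbar beta x + s ^ 2 * L12_rest hbar alpha beta gamma x s U V Y.

Definition L11_pole (hbar beta x : C) : C := hbar * (x - beta) / x.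
Definition L11_const (hbar gamma x : C) : C :=
  - (4 * gamma + hbar) / (4 * x).
Definition L11_rest (hbar beta gamma x s U V W : C) : C :=
  U + (- 1 / hbar * V + W * (beta * hbar ^ 2)
       - s * ((4 * gamma + hbar) / (4 * beta * hbar ^ 2)) * V
       + s ^ 2 * W * V) / x.
Definition L11_reg (hbar beta gamma x s U V W : C) : C :=
  L11_pole hbar beta x + s * L11_const hbar gamma x
  + s ^ 2 * L11_rest hbar beta gamma x s U V W.
Definition q2_reg (hbar beta s V : C) : C := beta * hbar ^ 2 + s ^ 2 * V.

Lemma L12_blowup (hbar t2 alpha beta gamma x s U V Y p2 : C) :
  s <> 0 -> x <> 0 ->
  L12 (alpha + s) t2 (q1_blowup hbar s U) (q2_blowup hbar beta s V)
      (p1_blowup hbar beta gamma s Y) p2 x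
  = L12_reg hbar alpha beta gamma x s U V Y / s ^ 2.
Proof.
intros. unfold L12, L12_reg, L12_rest, L12_pole, q1_blowup, q2_blowup.
field. now split.
Qed.

Lemma L11_blowup (hbar t1 t2 beta gamma x s U V W p1 : C) :
  s <> 0 -> x <> 0 -> hbar <> 0 -> beta <> 0 ->
  L11 t1 t2 (q1_blowup hbar s U) (q2_blowup hbar beta s V) p1
      (p2_blowup hbar beta gamma s W) x
  = L11_reg hbar beta gamma x s U V W / s.
Proof.
intros. unfold L11, L11_reg, L11_rest, L11_pole, L11_const, q1_blowup,
  q2_blowup, p2_blowup.
field. repeat split; assumption.
Qed.

(* [L11^2 + L12 L21] after cancellation of its poles of order 2 and 1 in [s]. *)
Definition Q_reg0 (hbar t2 alpha beta gamma x s U V Y W : C) : C :=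
  L11_const hbar gamma x ^ 2
  + 2 * L11_pole hbar beta x * L11_rest hbar beta gamma x s U V W
  + 2 * s * L11_const hbar gamma x * L11_rest hbar beta gamma x s U V W
  + s ^ 2 * L11_rest hbar beta gamma x s U V W ^ 2
  + L12_rest hbar alpha beta gamma x s U V Y
    * (1 - p1_blowup hbar beta gamma s Y / x)
  - L12_pole hbar beta x * Y / x
  + L12_reg hbar alpha beta gamma x s U V Y * t2
    / (q2_reg hbar beta s V * x ^ 2).

(** The double poles cancel because [L11_pole ^ 2 = - L12_pole * (1 - beta / x)]. The simple poles
    cancel because [2 * L11_pole * L11_const] equals [L12_pole / x] times the coefficient
    [1 / 2 + 2 * gamma / hbar] of [s] in [p1]. In the [t2] term, the double poles of [L12] and [q2]
    compensate. *)
Lemma Q_reg0_eq (hbar t2 alpha beta gamma x s U V Y W : C) :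
  s <> 0 -> x <> 0 -> hbar <> 0 -> beta <> 0 -> q2_reg hbar beta s V <> 0 ->
  (L11_reg hbar beta gamma x s U V W / s) ^ 2
  + L12_reg hbar alpha beta gamma x s U V Y / s ^ 2
    * (1 - p1_blowup hbar beta gamma s Y / x
       + t2 / (q2_reg hbar beta s V / s ^ 2 * x ^ 2))
  = Q_reg0 hbar t2 alpha beta gamma x s U V Y W.
Proof.
intros. unfold Q_reg0.
(* The cancellation concerns the pole parts alone, so both regular remainders are kept opaque and
   the identity stays small. *)
set (r := L11_rest _ _ _ _ _ _ _ _).
unfold L11_reg. fold r.
set (r' := L12_rest _ _ _ _ _ _ _ _ _).
unfold L12_reg. fold r'.
unfold L11_pole, L11_const, L12_pole, p1_blowup.
field. repeat split; assumption.
Qed.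

Definition Q_reg1 (hbar alpha beta gamma x s U V Y W : C) : C :=
  q2_reg hbar beta s V / x ^ 2
  * (- ((4 * gamma + hbar) / (4 * beta * hbar ^ 2)) * L12_pole hbar beta x
     + s * W * L12_pole hbar beta x
     + p2_blowup hbar beta gamma s W * L12_rest hbar alpha beta gamma x s U V Y
     - L11_const hbar gamma x
     - s * L11_rest hbar beta gamma x s U V W)
  + s * L11_reg hbar beta gamma x s U V W.

(** Over the denominator [s ^ 2 * L12_reg] the numerator is [q2_reg / x ^ 2 * (p2 * L12_reg - s *
    L11_reg) + s ^ 3 * L11_reg]. As [- L12_pole / hbar = L11_pole], the terms of order [s] in the
    bracket cancel and [s ^ 2] divides out. *)
Lemma Q_reg1_eq (hbar alpha beta gamma x s U V Y W : C) :
  s <> 0 -> x <> 0 -> hbar <> 0 -> beta <> 0 ->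
  L12_reg hbar alpha beta gamma x s U V Y <> 0 ->
  p2_blowup hbar beta gamma s W * (q2_reg hbar beta s V / s ^ 2) / x ^ 2
  + L11_reg hbar beta gamma x s U V W / s
    * (1 - q2_reg hbar beta s V / s ^ 2 / x ^ 2)
    / (L12_reg hbar alpha beta gamma x s U V Y / s ^ 2)
  = Q_reg1 hbar alpha beta gamma x s U V Y W
    / L12_reg hbar alpha beta gamma x s U V Y.
Proof.
intros Hs Hx Hh Hb Hl. unfold Q_reg1.
set (v := q2_reg _ _ _ _).
set (r := L11_rest _ _ _ _ _ _ _ _).
unfold L11_reg. fold r.
set (l := L12_reg _ _ _ _ _ _ _ _ _) in *.
transitivity ((p2_blowup hbar beta gamma s W * v * l / x ^ 2
  + s * (L11_pole hbar beta x + s * L11_const hbar gamma x + s ^ 2 * r)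
      * (s ^ 2 - v / x ^ 2)) / (s ^ 2 * l)).
{ field. repeat split; assumption. }
transitivity ((v / x ^ 2 * (p2_blowup hbar beta gamma s W * l
    - s * (L11_pole hbar beta x + s * L11_const hbar gamma x + s ^ 2 * r))
  + s ^ 3 * (L11_pole hbar beta x + s * L11_const hbar gamma x
             + s ^ 2 * r)) / (s ^ 2 * l)).
{ field. repeat split; assumption. }
(* This exhibits the factor [s ^ 2] of the bracket; the equality itself is checked last, once [l] is
   split into pole and remainder. *)
replace (p2_blowup hbar beta gamma s W * l
    - s * (L11_pole hbar beta x + s * L11_const hbar gamma x + s ^ 2 * r))
  with (s ^ 2 * (- ((4 * gamma + hbar) / (4 * beta * hbar ^ 2))
         * L12_pole hbar beta x
     + s * W * L12_pole hbar beta x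
     + p2_blowup hbar beta gamma s W * L12_rest hbar alpha beta gamma x s U V Y
     - L11_const hbar gamma x - s * r)).
{ field. repeat split; assumption. }
unfold l, L12_reg.
set (r' := L12_rest _ _ _ _ _ _ _ _ _).
unfold L12_pole, L11_pole, L11_const, p2_blowup.
field. repeat split; assumption.
Qed.

(** Here [q2] is only divided by [L12], and both have a double pole, so clearing [s ^ 2] in each
    quotient suffices. *)
Definition Q_reg2 (hbar alpha beta gamma x s U V Y : C) : C :=
  3 / 4 * ((s ^ 2 - q2_reg hbar beta s V / x ^ 2)
           / L12_reg hbar alpha beta gamma x s U V Y) ^ 2
  - q2_reg hbar beta s V / x ^ 3 / L12_reg hbar alpha beta gamma x s U V Y.

Lemma Q_Gar_blowup (hbar t2 alpha beta gamma x s U V Y W : C) :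
  s <> 0 -> x <> 0 -> hbar <> 0 -> beta <> 0 ->
  q2_reg hbar beta s V <> 0 ->
  L12_reg hbar alpha beta gamma x s U V Y <> 0 ->
  Q_Gar hbar (alpha + s) t2 (q1_blowup hbar s U) (q2_blowup hbar beta s V)
    (p1_blowup hbar beta gamma s Y) (p2_blowup hbar beta gamma s W) x
  = Q_reg0 hbar t2 alpha beta gamma x s U V Y W
    - hbar * (Q_reg1 hbar alpha beta gamma x s U V Y W
              / L12_reg hbar alpha beta gamma x s U V Y)
    + hbar ^ 2 * Q_reg2 hbar alpha beta gamma x s U V Y.
Proof.
intros Hs Hx Hh Hb Hv Hl.
rewrite Q_Gar_eq; [|exact Hx|].
2:{ rewrite L12_blowup by assumption. cneq. }
rewrite L11_blowup, L12_blowup by assumption. unfold L21.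
replace (q2_blowup hbar beta s V) with (q2_reg hbar beta s V / s ^ 2)
  by (unfold q2_reg, q2_blowup; field; exact Hs).
rewrite Q_reg0_eq, Q_reg1_eq by assumption.
f_equal. unfold Q_reg2. field. repeat split; assumption.
Qed.

(** At [s = 0], [L12_reg] is [L12_pole] and [q2_reg] is [beta * hbar ^ 2]. The three groups do not
    match [limQ0], [limQ1], [limQ2] one by one, because the combination [4 * gamma + hbar] mixes
    powers of [hbar]; only the totals agree. *)
Lemma Q_reg_lim (hbar t2 alpha beta gamma delta x : C) :
  x <> 0 -> x <> beta -> hbar <> 0 -> beta <> 0 ->
  let U := - (alpha - 2 * beta) / (3 * hbar) in
  let V := (alpha * beta - 2 * beta ^ 2) / 3 in
  let Y := (alpha ^ 2 - 4 * alpha * beta + 4 * beta ^ 2 + 45 * delta)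
      / (18 * hbar ^ 2) in
  let W := 2 * (alpha - 2 * beta) / (3 * hbar ^ 3) in
  Q_reg0 hbar t2 alpha beta gamma x 0 U V Y W
    - hbar * (Q_reg1 hbar alpha beta gamma x 0 U V Y W
              / L12_reg hbar alpha beta gamma x 0 U V Y)
    + hbar ^ 2 * Q_reg2 hbar alpha beta gamma x 0 U V Y
  = limQ0 alpha beta gamma delta x t2 + hbar * limQ1 beta gamma x
              + hbar ^ 2 * limQ2 beta x.
Proof.
intros Hx Hxb Hh Hb U V Y W. unfold U, V, Y, W.
unfold Q_reg0, Q_reg1, Q_reg2, L12_reg, L12_rest, L12_pole, L11_reg,
  L11_rest, L11_pole, L11_const, q2_reg, p1_blowup, p2_blowup,
  limQ0, limQ1, limQ2.
(* The denominators on the left contain [beta - x], those on the right [x - beta]. *)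
assert (H1 := Cminus_eq_contra _ _ Hxb).
assert (H2 := Cminus_eq_contra _ _ (not_eq_sym Hxb)).
field. repeat split; assumption.
Qed.

(** * Limits of [Q_Gar] and [A_Gar2] along the Laurent solution *)

Theorem theorem3p9
  (hbar t2 alpha beta gamma delta : C) (q1 q2 p1 p2 : C -> C)
  (hbar_neq0 : hbar <> 0) (t2_neq0 : t2 <> 0) (beta_neq0 : beta <> 0)
  (sol : laurent_solution hbar t2 alpha beta gamma delta q1 q2 p1 p2)
  (x : C) (x_neq0 : x <> 0) (x_neq_beta : x <> beta) :
  filterlim
    (fun t1 : C => Q_Gar hbar t1 t2 (q1 t1) (q2 t1) (p1 t1) (p2 t1) x)
    (locally' alpha)
    (locally (limQ0 alpha beta gamma delta x t2 + hbar * limQ1 beta gamma x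
              + hbar ^ 2 * limQ2 beta x)) /\
  filterlim
    (fun t1 : C => A_Gar2 t1 t2 (q1 t1) (q2 t1) (p1 t1) (p2 t1) x)
    (locally' alpha)
    (locally (beta * x / (t2 * (x - beta)))).
Proof.
destruct sol as [_ [Hq1 [Hq2 [Hp1 Hp2]]]].
apply q1_second_order in Hq1; [|exact hbar_neq0].
apply q2_second_order in Hq2; [|exact hbar_neq0].
apply p1_second_order in Hp1; [|exact hbar_neq0].
apply p2_second_order in Hp2; [|exact hbar_neq0|exact beta_neq0].
(* These functions solve the [_blowup] formulas for the bounded variables; their limits are the four
   facts just derived. *)
set (s := fun t : C => t - alpha).
set (U := fun t : C => (q1 t - hbar / (t - alpha)) / (t - alpha)).
set (V := fun t : C => q2 t - beta * hbar ^ 2 / (t - alpha) ^ 2).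
set (Y := fun t : C => (p1 t - beta - (1 / 2 + 2 * gamma / hbar) * (t - alpha))
      / (t - alpha) ^ 2).
set (W := fun t : C => (p2 t / (t - alpha) + 1 / hbar
        + (4 * gamma + hbar) / (4 * beta * hbar ^ 2) * (t - alpha))
      / (t - alpha) ^ 2).
change (filterlim U (locally' alpha)
  (locally (- (alpha - 2 * beta) / (3 * hbar)))) in Hq1.
change (filterlim V (locally' alpha)
  (locally ((alpha * beta - 2 * beta ^ 2) / 3))) in Hq2.
change (filterlim Y (locally' alpha)
  (locally ((alpha ^ 2 - 4 * alpha * beta + 4 * beta ^ 2 + 45 * delta)
      / (18 * hbar ^ 2)))) in Hp1.
change (filterlim W (locally' alpha)
  (locally (2 * (alpha - 2 * beta) / (3 * hbar ^ 3)))) in Hp2.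
assert (Hs : filterlim s (locally' alpha) (locally (RtoC 0))).
{ replace (RtoC 0) with (alpha - alpha) by ring. unfold s. clim. }
set (U0 := - (alpha - 2 * beta) / (3 * hbar)) in Hq1.
set (V0 := (alpha * beta - 2 * beta ^ 2) / 3) in Hq2.
set (Y0 := (alpha ^ 2 - 4 * alpha * beta + 4 * beta ^ 2 + 45 * delta)
      / (18 * hbar ^ 2)) in Hp1.
set (W0 := 2 * (alpha - 2 * beta) / (3 * hbar ^ 3)) in Hp2.
assert (Hl : filterlim
  (fun t => L12_reg hbar alpha beta gamma x (s t) (U t) (V t) (Y t))
  (locally' alpha) (locally (L12_reg hbar alpha beta gamma x 0 U0 V0 Y0))).
{ unfold L12_reg, L12_rest, p1_blowup. clim. }
assert (El0 : L12_reg hbar alpha beta gamma x 0 U0 V0 Y0 = L12_pole hbar beta x)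
  by (unfold L12_reg; ring).
assert (Hl0 : L12_reg hbar alpha beta gamma x 0 U0 V0 Y0 <> 0).
{ rewrite El0. unfold L12_pole. cneq. }
assert (Hv : filterlim (fun t => q2_reg hbar beta (s t) (V t))
  (locally' alpha) (locally (q2_reg hbar beta 0 V0))).
{ unfold q2_reg. clim. }
assert (Ev0 : q2_reg hbar beta 0 V0 = beta * hbar ^ 2)
  by (unfold q2_reg; ring).
assert (Hv0 : q2_reg hbar beta 0 V0 <> 0) by (rewrite Ev0; cneq).
(* Off [alpha] the solution is exactly in blown-up form, and near it both denominators are nonzero
   since their limits are. *)
assert (Hnear : locally' alpha (fun t : C =>
  s t <> 0 /\ q2_reg hbar beta (s t) (V t) <> 0 /\
  L12_reg hbar alpha beta gamma x (s t) (U t) (V t) (Y t) <> 0 /\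
  alpha + s t = t /\ q1 t = q1_blowup hbar (s t) (U t) /\
  q2 t = q2_blowup hbar beta (s t) (V t) /\
  p1 t = p1_blowup hbar beta gamma (s t) (Y t) /\
  p2 t = p2_blowup hbar beta gamma (s t) (W t))).
{ generalize (filter_and _ _ (locally'_C_neq alpha)
    (filter_and _ _ (filterlim_C_neq0 _ _ _ Hv Hv0)
       (filterlim_C_neq0 _ _ _ Hl Hl0))).
  apply filter_imp. intros t [Hst [Hvt Hlt]].
  repeat split; try assumption;
    unfold q1_blowup, q2_blowup, p1_blowup, p2_blowup, U, V, Y, W, s;
    field; repeat split; assumption. }
split.
(* The target becomes the regular expression at [s = 0], whose shape matches the function, so the
   limit can be taken termwise. *)
- rewrite <- Q_reg_lim by assumption. cbv zeta. fold U0 V0 Y0 W0.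
  apply (filterlim_ext_loc (fun t : C =>
    Q_reg0 hbar t2 alpha beta gamma x (s t) (U t) (V t) (Y t) (W t)
    - hbar * (Q_reg1 hbar alpha beta gamma x (s t) (U t) (V t) (Y t) (W t)
              / L12_reg hbar alpha beta gamma x (s t) (U t) (V t) (Y t))
    + hbar ^ 2 * Q_reg2 hbar alpha beta gamma x (s t) (U t) (V t) (Y t))).
  + generalize Hnear. apply filter_imp.
    intros t [Hst [Hvt [Hlt [Et [E1 [E2 [E3 E4]]]]]]].
    rewrite <- Q_Gar_blowup by assumption.
    now rewrite Et, <- E1, <- E2, <- E3, <- E4.
  + unfold Q_reg0, Q_reg1, Q_reg2, L11_reg, L11_rest, L12_rest, p1_blowup,
      p2_blowup.
    clim; cneq.
(* The double poles of [q2] and [L12] cancel in the quotient, leaving the ratio of their regular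
   parts. *)
- apply (filterlim_C_ext (locally' alpha)
    (fun t : C => - q2_reg hbar beta (s t) (V t)
      / (t2 * L12_reg hbar alpha beta gamma x (s t) (U t) (V t) (Y t)))
    _ (- q2_reg hbar beta 0 V0
       / (t2 * L12_reg hbar alpha beta gamma x 0 U0 V0 Y0))).
  + clim; cneq.
  + generalize Hnear. apply filter_imp.
    intros t [Hst [Hvt [Hlt [Et [E1 [E2 [E3 E4]]]]]]].
    unfold A_Gar2.
    assert (El := L12_blowup hbar t2 alpha beta gamma x (s t) (U t) (V t) (Y t)
      (p2 t) Hst x_neq0).
    rewrite Et, <- E1, <- E2, <- E3 in El. rewrite El, E2.
    unfold M2_12, q2_reg, q2_blowup. field. repeat split; assumption.
  + rewrite El0, Ev0. unfold L12_pole. field.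
    repeat split; cneq.
Qed.
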